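(* Assume GCH. Suppose $X$ and $Y$ are isodyne topological spaces. Then: (1) if $|X| = |Y|$ is an isolated cardinal, then $X \times Y$ is maximally resolvable; (2) if $\mathrm{cf}|X| = \mathrm{cf}|Y|$ is an isolated cardinal, then $X \times Y$ is $\mathrm{cf}|X|$-resolvable; (3) if the cardinals $|X|$ and $|Y|$ are neighboring, then $X \times Y$ is maximally resolvable; (4) if $|X| = \aleph_\omega$ and $|Y| = \omega_1$, then $X \times Y$ is $\omega_1$-resolvable.
   Context: For a topological space $Z$, the dispersion character is $\Delta(Z) = \min\{|U| : U \text{ is a nonempty open subset of } Z\}$. A space $Z$ is isodyne if $|Z| = \Delta(Z)$. For a cardinal $\tau$, a space $Z$ is $\tau$-resolvable if $Z$ can be partitioned into $\tau$-many (pairwise disjoint) dense subsets; $Z$ is maximally resolvable if it is $\Delta(Z)$-resolvable. An isolated cardinal is a cardinal of the form $\kappa^+$ with $\kappa$ an infinite cardinal. Two cardinals are neighboring if they are of the form $\kappa$ and $\kappa^+$ (in either order) for some infinite cardinal $\kappa$. $\mathrm{cf}$ denotes cofinality. GCH is the generalized continuum hypothesis: $2^\kappa = \kappa^+$ for every infinite cardinal $\kappa$. No separation axioms are assumed. *)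

(* Defs.v *)
From mathcomp Require Import all_boot.
From mathcomp Require Import all_classical topology.
From mathcomp Require Import wochoice.

Set Implicit Arguments.
Unset Strict Implicit.
Unset Printing Implicit Defensive.

Local Open Scope classical_set_scope.
Local Open Scope card_scope.

(* A cardinal is represented by any set [A : set T] (over any type [T]) having
   that cardinality; cardinals are compared with [#=] and [#<=].  Accordingly,
   cardinal-valued operations are relations that hold of every representative
   of their value. *)

Definition card_lt T U (A : set T) (B : set U) : Prop :=
  A #<= B /\ ~~ (B #<= A).

(* |B| = |A|^+, meaningful for infinite A *)
Definition is_succ_card T U (A : set T) (B : set U) : Prop :=
  card_lt A B /\ forall (V : Type) (C : set V), card_lt A C -> B #<= C.

Definition isolated_cardinal U (B : set U) : Prop :=
  exists (T : Type) (A : set T), infinite_set A /\ is_succ_card A B.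

Definition neighboring T U (A : set T) (B : set U) : Prop :=
  (infinite_set A /\ is_succ_card A B) \/ (infinite_set B /\ is_succ_card B A).

Definition GCH : Prop :=
  forall (T : Type) (A : set T),
    infinite_set A -> is_succ_card A [set S : set T | S `<=` A].

Fixpoint is_aleph (n : nat) (U : Type) (B : set U) : Prop :=
  if n is m.+1 then
    exists (T : Type) (A : set T), is_aleph m A /\ is_succ_card A B
  else B #= [set: nat].

(* aleph_omega is the supremum of the aleph_n, n < omega *)
Definition is_aleph_omega U (B : set U) : Prop :=
  (forall n (T : Type) (A : set T), is_aleph n A -> A #<= B) /\
  forall (V : Type) (C : set V),
    (forall n (T : Type) (A : set T), is_aleph n A -> A #<= C) -> B #<= C.

(* The reflexive well-order [R] makes T an ordinal; that ordinal is the cardinal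
   |T| iff every proper initial segment, i.e. every {y | y < x}, has cardinality
   less than |T|. *)
Definition initial_order T (R : rel T) : Prop :=
  well_order R /\ forall x, card_lt [set y | ~~ R x y] [set: T].

Definition cofinal_subset T (R : rel T) (D : set T) : Prop :=
  forall x, exists2 y, D y & R x y.

(* cf |T| = |K|: the least cardinality of a cofinal subset of the initial
   ordinal |T|.  The order R always exists and is unique up to isomorphism. *)
Definition is_cofinality T U (K : set U) : Prop :=
  exists R : rel T, [/\ initial_order R,
    exists2 D : set T, cofinal_subset R D & D #= K &
    forall D : set T, cofinal_subset R D -> K #<= D].
Arguments is_cofinality T {U} K.

(* Delta(Z) = |K| *)
Definition is_dispersion_character (Z : topologicalType) U (K : set U) : Prop :=
  (exists V : set Z, [/\ open V, V !=set0 & V #= K]) /\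
  forall V : set Z, open V -> V !=set0 -> K #<= V.
Arguments is_dispersion_character Z {U} K.

Definition isodyne (Z : topologicalType) : Prop :=
  is_dispersion_character Z [set: Z].

(* The partition is indexed by K; its blocks are nonempty and pairwise disjoint,
   so it has exactly |K| of them. *)
Definition resolvable U (K : set U) (Z : topologicalType) : Prop :=
  exists F : U -> set Z,
    partition K F [set: Z] /\ forall i, K i -> dense (F i).

(* Delta(Z) is attained by an open subset of Z, so representatives of it may be
   taken among the subsets of Z. *)
Definition maximally_resolvable (Z : topologicalType) : Prop :=
  exists K : set Z, is_dispersion_character Z K /\ resolvable K Z.

(* Main.v *)
Require Import Defs.
From mathcomp Require Import all_boot.
From mathcomp Require Import all_classical topology.
From mathcomp Require Import wochoice.
From Stdlib Require Import Inverse_Image.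

Set Implicit Arguments.
Unset Strict Implicit.
Unset Printing Implicit Defensive.

Local Open Scope classical_set_scope.
Local Open Scope card_scope.

(** The four claims follow from one colouring.  If |B| = |A|^+ with A infinite,
GCH yields f : B -> B -> B that takes every value on every rectangle P x Q
with |A| <= |P| and |B| <= |Q| ([rectangle_coloring]).  It is built column by
column along a well-order of B of type |B|.  Under GCH there are only |B|
injections h : A -> B, and the column of q only has to deal with the injections
h and the colours c that come before q, so with at most |A| pairs (h, c).  Since
each range of h has |A| points, one can pick distinct points in these ranges,
one for each pair, and give the point of (h, c) the colour c.  If P contains
the range of h and c is any colour, then every q in Q late enough has a point
of P of colour c in its column, and Q has such a q because |Q| = |B|.

Maps g : X -> B and h : Y -> B such that g sends nonempty open sets to sets of
size at least |A| and h to sets of size |B| (or with the roles exchanged) turn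
the fibres of f (g x) (h y) into |B| disjoint dense subsets of X x Y
([resolvable_prod_succ]).  When |X| and |Y| are A or B, injections will do,
because the nonempty open sets are as large as the whole space.  When B is the
common cofinality, a map that sends each point to a larger element of a
smallest cofinal set will do ([cofinality_big_on_opens]).  When |X| is
aleph_omega, A is countable and X is mapped to nat so that each full-size
subset has infinite image ([aleph_omega_partition]).

The cardinal arithmetic rests on a greedy choice along a well-order
([greedy_choice]), from which follow the comparability of cardinals, induction
on cardinals, and |T x T| = |T| for infinite T. *)

(** * Cardinal comparisons by functions *)

Lemma card_le_intro T U (A : set T) (B : set U) (f : T -> U) :
  (forall x, A x -> B (f x)) ->
  (forall x y, A x -> A y -> f x = f y -> x = y) -> A #<= B.
Proof.
move=> fAB finj.
have fI : {in A &, injective f}.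
  by move=> x y; rewrite !inE => Ax Ay; apply: finj.
have := inj_card_eq fI; rewrite card_eq_le => /andP[_ /card_le_trans]; apply.
by apply: subset_card_le => _ [x Ax <-]; exact: fAB.
Qed.

Lemma card_le_funP T U (B : set U) :
  [set: T] #<= B <-> exists f : T -> U, injective f /\ forall x, B (f x).
Proof.
split=> [/card_leP[f]|[f [finj fB]]]; last first.
  by apply: (@card_le_intro _ _ _ _ f) => // x y _ _ /finj.
pose i (x : T) : [set: T] := SigSub (mem_setT x).
exists (fun x => val (f (i x))); split=> [x y /val_inj|x].
  by move=> /(inj (f:=f) (mem_setT _) (mem_setT _))/(congr1 val).
exact: set_valP.
Qed.

Lemma card_eq_bij T U (B : set U) :
  [set: T] #= B ->
  exists f : T -> U, [/\ injective f, forall x, B (f x) &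
                         forall y, B y -> exists x, f x = y].
Proof.
move=> /card_eqVP[f].
pose i (x : T) : [set: T] := SigSub (mem_setT x).
exists (fun x => val (f (i x))); split=> [x y /val_inj|x|y By].
- by move=> /(inj (f:=f) (mem_setT _) (mem_setT _))/(congr1 val).
- exact: set_valP.
- have [u _ fu] := @surj _ _ _ _ f (SigSub (mem_set By)) I.
  by exists (val u); rewrite (_ : i _ = u) ?fu//; exact/val_inj.
Qed.

Lemma card_le_setT T U (A : set T) (B : set U) :
  ([set: A] #<= [set: B]) = (A #<= B).
Proof. by rewrite (card_le_eql (card_setT A)) (card_le_eqr (card_setT B)). Qed.

(** * Well-orders and greedy choice *)

(** Transitivity and irreflexivity follow from these two conditions. *)
Definition strict_wo T (lt : T -> T -> Prop) :=
  well_founded lt /\ forall x y, x <> y -> lt x y \/ lt y x.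

Section StrictWellOrder.
Variables (T : Type) (lt : T -> T -> Prop).
Hypothesis lt_wo : strict_wo lt.

Lemma strict_wo_irr x : ~ lt x x.
Proof. by elim/(well_founded_ind lt_wo.1): x => x ih xx; exact: (ih x xx xx). Qed.

Lemma strict_wo_asym x y : lt x y -> ~ lt y x.
Proof.
elim/(well_founded_ind lt_wo.1): x y => x ih y xy yx; exact: (ih y yx x yx xy).
Qed.

Lemma strict_wo_trans x y z : lt x y -> lt y z -> lt x z.
Proof.
elim/(well_founded_ind lt_wo.1): x y z => x ih y z xy yz.
have [xz|/lt_wo.2[//|zx]] := pselect (x = z).
  by case: (strict_wo_asym xy); rewrite xz.
by case: (strict_wo_asym yz (ih _ zx _ _ zx xy)).
Qed.

Lemma strict_wo_preimage U (f : U -> T) :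
  injective f -> strict_wo (fun x y => lt (f x) (f y)).
Proof.
move=> finj; split; last by move=> x y xy; apply: lt_wo.2 => /finj.
exact: (wf_inverse_image _ _ _ f lt_wo.1).
Qed.

(** Ties of the ranking m are broken by lt'. *)
Lemma strict_wo_refine U (m : U -> T) (lt' : U -> U -> Prop) :
  strict_wo lt' ->
  strict_wo (fun x y => lt (m x) (m y) \/ m x = m y /\ lt' x y).
Proof.
move=> lt'_wo; split.
  move=> x; have [t] : exists t, t = m x by exists (m x).
  elim/(well_founded_ind lt_wo.1): t x => t iht x.
  elim/(well_founded_ind lt'_wo.1): x => x ihx tx.
  constructor=> y [yx|[yx lyx]]; first by apply: (iht (m y)) => //; rewrite tx.
  by apply: ihx => //; rewrite yx.
move=> x y xy; have [mxy|/lt_wo.2[]] := pselect (m x = m y); 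
  [|by left; left|by right; left].
by have [] := lt'_wo.2 _ _ xy; [left|right]; right.
Qed.

(** Recursion along the well-order: the values chosen before x are at most as
many as the predecessors of x, so they cannot exhaust S x. *)
Lemma greedy_choice V (S : T -> set V) :
  (forall x, ~ (S x #<= [set y | lt y x])) ->
  exists p : T -> V, injective p /\ forall x, S x (p x).
Proof.
move=> Sbig.
(* Otherwise every v in S x is the value of rec at some y before x, and v |-> y
   injects S x into the predecessors of x. *)
have step x (rec : forall y, lt y x -> V) :
    exists v, S x v /\ forall y (yx : lt y x), rec y yx <> v.
  apply: contrapT => none; apply: (Sbig x).
  have hit v : exists y, S x v -> exists yx : lt y x, rec y yx = v.
    have [Sv|nSv] := pselect (S x v); last by exists x.
    apply: contrapT => nv; apply: none; exists v; split=> // y yx ryv.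
    by apply: nv; exists y => _; exists yx.
  have [j jP] := choice hit.
  apply: (@card_le_intro _ _ _ _ j) => [v /jP[]//|v w Sv Sw jvw].
  have [vx <-] := jP v Sv; have [wx <-] := jP w Sw.
  case: _ / jvw wx => wx; congr rec; exact: Prop_irrelevance.
pose stepf x rec := projT1 (cid (step x rec)).
pose p := Fix lt_wo.1 (fun=> V) stepf.
have pE x : p x = stepf x (fun y _ => p y).
  apply: (Fix_eq lt_wo.1 (fun=> V) stepf) => y f g fg; congr stepf.
  apply: functional_extensionality_dep => z.
  exact: functional_extensionality_dep.
have pS x : S x (p x) by rewrite pE /stepf; case: cid => v [].
have pN x y : lt y x -> p y <> p x.
  by move=> yx; rewrite (pE x) /stepf; case: cid => v /= [_ nv]; exact: (nv y yx).
exists p; split=> // x y pxy; apply: contrapT => /lt_wo.2[/pN|/pN]; exact.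
Qed.

(** If V embeds in no initial segment, points of V can be chosen greedily
along T. *)
Lemma card_le_initial_segment V :
  [set: T] #<= [set: V] \/ exists x, [set: V] #<= [set y | lt y x].
Proof.
have [?|nx] := pselect (exists x, [set: V] #<= [set y | lt y x]); first by right.
left; have [|p [pinj _]] := @greedy_choice V (fun=> setT).
  by move=> x Vx; apply: nx; exists x.
by apply/card_le_funP; exists p.
Qed.

End StrictWellOrder.

Lemma well_order_strict T (R : rel T) :
  well_order R -> strict_wo (fun x y => ~~ R y x).
Proof.
move=> Rwo.
have minR (D : set T) : D !=set0 ->
    exists2 z, D z & forall y, D y -> R z y.
  move=> [x Dx]; have [|z [[/asboolP Dz zmin] _]] := Rwo (fun t => `[<D t>]).
    by exists x; exact/asboolP.
  by exists z => // y Dy; apply: zmin; exact/asboolP.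
split.
  move=> x; apply: contrapT => nx.
  have [|z nz zmin] := minR (fun x => ~ Acc (fun x y => ~~ R y x) x); first by exists x.
  by apply: nz; constructor => y /negP yz; apply: contrapT => /zmin.
move=> x y xy; apply: contrapT => /not_orP[/negP + /negP].
rewrite !negbK => Ryx Rxy.
have refl t : R t t by have [|z -> ->] := minR [set t]; first by exists t.
have [|z [_ uz]] := Rwo (fun t => `[<t = x \/ t = y>]).
  by exists x; apply/asboolP; left.
apply: xy; rewrite -(uz x) ?(uz y) //; split; try by apply/asboolP; auto.
  by move=> t /asboolP[] ->.
by move=> t /asboolP[] ->.
Qed.

Lemma exists_strict_wo T : exists lt : T -> T -> Prop, strict_wo lt.
Proof.
have [R Rwo] := well_ordering_principle {classic T}.
by exists (fun x y => ~~ R y x); exact: well_order_strict.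
Qed.

Lemma card_le_total T U (A : set T) (B : set U) : A #<= B \/ B #<= A.
Proof.
rewrite -(card_le_setT A B) -(card_le_setT B A).
have [lt lt_wo] := exists_strict_wo A.
have [|[x Bx]] := card_le_initial_segment lt_wo B; [by left|right].
exact: card_le_trans Bx (card_leT _).
Qed.

(** Any well-order of T witnesses that cardinals below |T| are well-founded: a
smaller V embeds in an initial segment, and induction on the endpoint of the
segment applies. *)
Lemma cardinal_ind (P : Type -> Prop) :
  (forall T, (forall V, ~ ([set: T] #<= [set: V]) -> P V) -> P T) ->
  forall T, P T.
Proof.
move=> step T; have [lt lt_wo] := exists_strict_wo T.
have seg x : forall V, [set: V] #<= [set y | lt y x] -> P V.
  elim/(well_founded_ind lt_wo.1): x => x ih V Vx; apply: step => W VW.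
  pose S := set_type [set y | lt y x].
  have [SW|[s Ws]] := card_le_initial_segment
      (strict_wo_preimage lt_wo (@val_inj _ _ S)) W.
    case: VW; apply: card_le_trans Vx _; apply: card_le_trans SW.
    by rewrite (card_le_eqr (card_setT _)) card_lexx.
  apply: (ih (val s) (set_valP s)).
  apply: card_le_trans Ws _; apply: (@card_le_intro _ _ _ _ val) => //.
  by move=> ? ? _ _ /val_inj.
apply: step => V TV; have [//|[x]] := card_le_initial_segment lt_wo V.
exact: seg.
Qed.

(** The order type of lt is the cardinal |T|. *)
Definition initial_wo T (lt : T -> T -> Prop) :=
  strict_wo lt /\ forall x, ~ ([set: T] #<= [set y | lt y x]).

(** If some initial segment of a well-order has full size, take the shortest one
and transport its order to T. *)
Lemma exists_initial_wo T : exists lt : T -> T -> Prop, initial_wo lt.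
Proof.
have [lt lt_wo] := exists_strict_wo T.
have [[x Tx]|nx] := pselect (exists x, [set: T] #<= [set y | lt y x]); last first.
  by exists lt; split=> // x Tx; apply: nx; exists x.
elim/(well_founded_ind lt_wo.1): x Tx => x ih Tx.
have [[y yx Ty]|ny] := pselect (exists2 y, lt y x & [set: T] #<= [set z | lt z y]).
  exact: ih yx Ty.
have /card_le_funP[f [finj fx]] := Tx.
exists (fun a b => lt (f a) (f b)); split; first exact: strict_wo_preimage.
move=> a Ta; apply: ny; exists (f a); first exact: fx.
by apply: card_le_trans Ta _; apply: (@card_le_intro _ _ _ _ f) => // ? ? _ _ /finj.
Qed.

(** * Products of infinite cardinals *)

Lemma card_le_infinite T U (A : set T) (B : set U) :
  A #<= B -> infinite_set A -> infinite_set B.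
Proof. by move=> AB infA /(card_le_finite AB). Qed.

Lemma infinite_setT_sub T (A : set T) : infinite_set A -> infinite_set [set: A].
Proof. by apply: card_le_infinite; rewrite (card_le_eqr (card_setT _)). Qed.

Lemma card_setU1_infinite T (x : T) (A : set T) :
  infinite_set A -> x |` A #<= A.
Proof.
move=> infA; have [Ax|nAx] := pselect (A x).
  by rewrite setUidr // => _ ->.
have /infiniteP/card_le_funP[i [iinj iA]] := infA.
(* Hilbert's hotel along the sequence i: x takes the place of i 0. *)
pose g y := if pselect (y = x) then i 0 else
  if pselect (exists n, y = i n) is left e then i (projT1 (cid e)).+1 else y.
have gx : g x = i 0 by rewrite /g; case: (pselect (x = x)).
have gi n : g (i n) = i n.+1.
  rewrite /g; case: (pselect (i n = x)) => [ix|nix] /=.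
    by case: nAx; rewrite -ix.
  case: (pselect (exists m, i n = i m)) => [e|[]]; last by exists n.
  by case: cid => m /= im; rewrite (iinj _ _ im).
have gE y : y <> x -> ~ (exists n, y = i n) -> g y = y.
  rewrite /g; case: (pselect (y = x)) => //= yx _.
  by case: (pselect (exists n, y = i n)).
have cases y : [\/ y = x, exists n, y = i n | g y = y /\ ~ exists n, y = i n].
  have [->|yx] := pselect (y = x); first by constructor 1.
  have [?|ny] := pselect (exists n, y = i n); first by constructor 2.
  by constructor 3; split=> //; exact: gE.
apply: (@card_le_intro _ _ _ _ g) => [y [->|Ay]|y z _ _].
- by rewrite gx.
- case: (cases y) => [->|[n ->]|[-> _]//]; rewrite ?gx ?gi //.
- case: (cases y) => [->|[n ->]|[-> ny]];
    case: (cases z) => [->|[m ->]|[-> nz]];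
    rewrite ?gx ?gi // => /esym.
  + by move/iinj.
  + by move=> e; case: nz; exists 0.
  + by move/iinj.
  + by move/iinj => [->].
  + by move=> e; case: nz; exists n.+1.
  + by move=> e; case: ny; exists 0.
  + by move=> e; case: ny; exists m.+1.
Qed.

(** Adding its endpoint to an initial segment does not make it full-size. *)
Lemma initial_wo_closed_segment T (lt : T -> T -> Prop) (x : T) :
  infinite_set [set: T] -> initial_wo lt -> ~ ([set: T] #<= [set y | ~ lt x y]).
Proof.
move=> infT [lt_wo lt_init].
have -> : [set y | ~ lt x y] = x |` [set y | lt y x].
  apply/seteqP; split=> y /=;
    last by move=> [->|/(strict_wo_asym lt_wo)//]; exact: strict_wo_irr lt_wo _.
  move=> nxy; have [->|/lt_wo.2[]//] := pselect (y = x); [by left|by right].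
move=> Tx; apply: (lt_init x); apply: (card_le_trans Tx).
apply: card_setU1_infinite => finx.
apply: card_le_infinite Tx infT _; rewrite finite_setU; split=> //; exact: finite_set1.
Qed.

Lemma card_setX_le T U T' U' (A : set T) (B : set U)
    (A' : set T') (B' : set U') :
  A #<= A' -> B #<= B' -> A `*` B #<= A' `*` B'.
Proof.
rewrite -(card_le_setT A) -(card_le_setT B).
move=> /card_le_funP[f [finj _]] /card_le_funP[g [ginj _]].
rewrite -card_le_setT; apply/card_le_funP.
pose h (u : set_type (A `*` B)) : T' * U' :=
  (val (f (SigSub (mem_set (set_valP u).1))),
   val (g (SigSub (mem_set (set_valP u).2)))).
have hP u : (A' `*` B') (h u) by split; exact: set_valP.
exists (fun u => SigSub (mem_set (hP u))); split=> // u v /(congr1 val)[].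
move=> /val_inj/finj/(congr1 val)/= e1 /val_inj/ginj/(congr1 val)/= e2.
by apply: val_inj; rewrite [LHS]surjective_pairing e1 e2 -surjective_pairing.
Qed.

(** Goedel's ordering: rank the pairs by their larger coordinate.  The pairs up
to u have both coordinates in E, the points up to the larger coordinate of u.
Since |E| < |T|, induction gives |E x E| < |T|, and pairs can be sent to points
of T greedily. *)
Lemma card_setX_infinite_type T :
  infinite_set [set: T] -> [set: T * T] #<= [set: T].
Proof.
elim/cardinal_ind: T => T ih infT.
have [lt lt_init] := exists_initial_wo T.
have [lt_wo lt_seg] := lt_init.
have [lt' lt'_wo] := exists_strict_wo (T * T)%type.
pose m (u : T * T) := if pselect (lt u.1 u.2) then u.2 else u.1.
have [u Tu|p [pinj _]] := greedy_choice (strict_wo_refine lt_wo m lt'_wo)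
    (S := fun=> [set: T]); last by apply/card_le_funP; exists p.
pose E := [set y | ~ lt (m u) y].
have mE v w : ~ lt (m u) (m v) -> w = v.1 \/ w = v.2 -> E w.
  have [[lv ->]|[lv ->]] :
      lt v.1 v.2 /\ m v = v.2 \/ ~ lt v.1 v.2 /\ m v = v.1.
    by rewrite /m; case: (pselect (lt v.1 v.2)) => lv /=; [left|right].
  - move=> muv [] -> // muw; apply: muv.
    exact: (strict_wo_trans lt_wo) muw lv.
  - move=> muv [] -> // muw; apply: muv.
    have [->//|/lt_wo.2[]//] := pselect (v.1 = v.2).
    exact: (strict_wo_trans lt_wo).
have TEE : [set: T] #<= E `*` E.
  apply: card_le_trans Tu (subset_card_le _) => v /= vu.
  have muv : ~ lt (m u) (m v).
    case: vu => [/(strict_wo_asym lt_wo)//|[-> _]]; exact: strict_wo_irr lt_wo _.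
  by split; apply: mE muv _; [left|right].
have TE : ~ ([set: T] #<= E) by exact: initial_wo_closed_segment.
have infE : infinite_set E.
  by move=> finE; apply: card_le_infinite TEE infT _; exact: finite_setX.
apply: (TE); apply: card_le_trans TEE _.
have EE : [set: E * E] #<= [set: E].
  by apply: ih (infinite_setT_sub infE); rewrite (card_le_eqr (card_setT _)).
rewrite (card_le_eqr (card_setT _)) in EE; apply: card_le_trans EE.
have -> : [set: E * E] = [set: E] `*` [set: E] by apply/seteqP.
by apply: card_setX_le; rewrite (card_le_eqr (card_setT _)) card_lexx.
Qed.

Lemma infinite_card_setT_prod T U (A : set T) :
  infinite_set A -> [set: U] #<= A -> [set: U * U] #<= A.
Proof.
move=> infA UA; have := card_setX_infinite_type (infinite_setT_sub infA).
rewrite (card_le_eqr (card_setT _)); apply: card_le_trans.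
apply: (@card_le_trans _ _ _ ([set: A] `*` [set: A])); last exact: card_leT.
have -> : [set: U * U] = [set: U] `*` [set: U] by apply/seteqP.
by apply: card_setX_le; rewrite (card_le_eqr (card_setT _)).
Qed.

(** * The colouring *)

(** Along a well-order of I of type |I|, each S i is larger than what earlier
indices used. *)
Lemma injective_choice I V (S : I -> set V) :
  (forall i, [set: I] #<= S i) ->
  exists p : I -> V, injective p /\ forall i, S i (p i).
Proof.
move=> IS; have [lt [lt_wo lt_seg]] := exists_initial_wo I.
apply: (greedy_choice lt_wo) => i Si.
exact: (lt_seg i) (card_le_trans (IS i) Si).
Qed.

Section Successor.
Variables (gch : GCH) (A B : Type).
Hypotheses (infA : infinite_set [set: A]) (AB : is_succ_card [set: A] [set: B]).

(** Nothing lies strictly between |A| and |A|^+. *)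
Lemma card_le_of_below_succ T (C : set T) : ~ ([set: B] #<= C) -> C #<= [set: A].
Proof.
move=> BC; have [//|AC] := card_le_total C [set: A].
apply: contrapT => CA; apply: BC; apply: AB.2; split=> //; exact/negP.
Qed.

(** Here B and the power set of A are both successors of A, so functions A -> B
embed in subsets of A x A, hence in subsets of A, hence in B. *)
Lemma card_fun_succ : [set: A -> B] #<= [set: B].
Proof.
have subT : [set S : set A | S `<=` [set: A]] = setT by apply/seteqP.
have [AP leP] := gch infA; rewrite subT in AP leP.
have /card_le_funP[i [iinj _]] : [set: B] #<= [set: set A] by exact: AB.2.
have /card_le_funP[j [jinj _]] := leP _ _ AB.1.
have /card_le_funP[k [kinj _]] := card_setX_infinite_type infA.
apply/card_le_funP.
exists (fun h => j [set k u | u in [set u | i (h u.1) u.2]]); split=> //.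
move=> g h /jinj gh; apply: functional_extensionality_dep => a; apply: iinj.
have sub (h1 h2 : A -> B) :
    [set k u | u in [set u : A * A | i (h1 u.1) u.2]] =
    [set k u | u in [set u | i (h2 u.1) u.2]] -> i (h1 a) `<=` i (h2 a).
  move=> e b hb; have : [set k u | u in [set u : A * A | i (h2 u.1) u.2]] (k (a, b)).
    by rewrite -e; exists (a, b).
  by move=> [[a' b'] /= + /kinj[<- <-]].
by apply/seteqP; split; apply: sub.
Qed.

(** The injections A -> B are listed in B by e.  Column q treats the tasks (h, c)
with e h and c before q; a task asks for a point of the range of h with
colour c. *)
Lemma rectangle_coloring : exists f : B -> B -> B,
  forall P Q : set B, [set: A] #<= P -> [set: B] #<= Q ->
  forall c, exists2 p, P p & exists2 q, Q q & f p q = c.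
Proof.
have [lt lt_init] := exists_initial_wo B; have [lt_wo lt_seg] := lt_init.
have infB : infinite_set [set: B].
  by apply: card_le_infinite infA; case: AB.1.
have /card_le_funP[e [einj _]] := card_fun_succ.
have column q : exists phi : B -> B, forall (h : A -> B) c,
    injective h -> lt (e h) q -> lt c q -> exists a, phi (h a) = c.
  pose task := [set hc : (A -> B) * B |
    [/\ injective hc.1, lt (e hc.1) q & lt hc.2 q]].
  have taskA : [set: task] #<= [set: A].
    have segA : [set: [set c | lt c q]] #<= [set: A].
      rewrite (card_le_eql (card_setT _)).
      exact/card_le_of_below_succ/lt_seg.
    apply: card_le_trans (infinite_card_setT_prod infA segA).
    have hq (t : task) : [set c | lt c q] (e (val t).1).
      by have [] := set_valP t.
    have cq (t : task) : [set c | lt c q] (val t).2 by have [] := set_valP t.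
    apply/card_le_funP.
    exists (fun t => (SigSub (mem_set (hq t)), SigSub (mem_set (cq t)))).
    split=> // s t [/einj e1 e2]; apply: val_inj.
    by rewrite [LHS]surjective_pairing e1 e2 -surjective_pairing.
  have [|p [pinj pP]] := @injective_choice task B (fun t => range (val t).1).
    move=> t; apply: card_le_trans taskA _; apply/card_le_funP.
    have [tinj _ _] := set_valP t.
    by exists (val t).1; split=> // a; exists a.
  pose phi b := if pselect (exists t, p t = b) is left E
    then (val (projT1 (cid E))).2 else b.
  have phiE t : phi (p t) = (val t).2.
    rewrite /phi; case: pselect => [E|[]]; last by exists t.
    by case: cid => s /= ps; rewrite (pinj _ _ ps).
  exists phi => h c hinj hq cq.
  have th : task (h, c) by [].
  have [a _ pa] := pP (SigSub (mem_set th)).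
  by exists a; rewrite -[h a]/((h, c).1 a) pa phiE.
have [f fP] := choice column.
exists (fun p q => f q p) => P Q /card_le_funP[h [hinj hP]] BQ c.
(* Q is not contained in the segment up to the larger of e h and c. *)
have [q Qq [hq cq]] : exists2 q, Q q & lt (e h) q /\ lt c q.
  pose m := if pselect (lt (e h) c) then c else e h.
  have [q Qq mq] : exists2 q, Q q & lt m q.
    apply: contrapT => nq.
    apply: (initial_wo_closed_segment (x := m) infB lt_init).
    by apply: card_le_trans BQ (subset_card_le _) => q Qq mq; apply: nq; exists q.
  exists q => //; move: mq; rewrite /m; case: pselect => [hc cq|hc hq].
    by split=> //; exact: (strict_wo_trans lt_wo) hc cq.
  split=> //; have [<-//|/lt_wo.2[//|ch]] := pselect (e h = c).
  exact: (strict_wo_trans lt_wo) ch hq.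
have [a fa] := fP q h c hinj hq cq.
by exists (h a) => //; exists q.
Qed.

End Successor.

Lemma card_prod_absorb T U :
  infinite_set [set: U] -> [set: T] #<= [set: U] -> [set: T] !=set0 ->
  [set: T * U] #= [set: U].
Proof.
move=> infU TU [t _]; rewrite card_eq_le; apply/andP; split.
  apply: card_le_trans (card_setX_infinite_type infU).
  have setTE V : [set: V * U] = [set: V] `*` [set: U] by apply/seteqP.
  by rewrite !setTE; exact: card_setX_le.
by apply: (@card_le_intro _ _ _ _ (pair t)) => // x y _ _ [].
Qed.

Lemma card_prodC T U : [set: T * U] #= [set: U * T].
Proof.
have swap V W : [set: V * W] #<= [set: W * V].
  apply: (@card_le_intro _ _ _ _ (fun u => (u.2, u.1))) => //.
  by move=> -[a b] [c d] _ _ [-> ->].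
by rewrite card_eq_le !swap.
Qed.

(** * Resolving products *)

Section Products.
Variables X Y : topologicalType.

Lemma open_prod_box (O : set (X * Y)) : open O -> O !=set0 ->
  exists V W, [/\ open V, V !=set0, open W, W !=set0 & V `*` W `<=` O].
Proof.
move=> oO [[x y] Oxy].
have [[V W] [/= /nbhs_interior Vx /nbhs_interior Wy] VWO] :
    nbhs (x, y) O by exact: open_nbhs_nbhs.
exists (interior V), (interior W); split; try exact: open_interior.
- by exists x; exact: nbhs_singleton.
- by exists y; exact: nbhs_singleton.
- move=> -[a b] [/= /interior_subset Va /interior_subset Wb]; exact: VWO.
Qed.

Lemma resolvable_prod U (K : set U) (f : X * Y -> U) :
  (exists V : set X, open V /\ V !=set0) ->
  (exists W : set Y, open W /\ W !=set0) ->
  (forall u, K (f u)) ->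
  (forall V W, open V -> V !=set0 -> open W -> W !=set0 ->
    forall c, K c -> exists2 u, (V `*` W) u & f u = c) ->
  resolvable K (X * Y)%type.
Proof.
move=> [V0 [oV0 V00]] [W0 [oW0 W00]] fK fbox.
exists (fun c => f @^-1` [set c]); split.
  split.
  - by apply/seteqP; split=> // u _; exists (f u).
  - by move=> c d _ _ [u [/= <- <-]].
  - move=> c Kc; have [u _ fu] := fbox _ _ oV0 V00 oW0 W00 c Kc; by exists u.
move=> c Kc O O0 oO; have [V [W [oV V0' oW W0' VWO]]] := open_prod_box oO O0.
by have [u /VWO Ou fu] := fbox _ _ oV V0' oW W0' c Kc; exists u.
Qed.

(** Each box V x W is as large as X x Y, so the dispersion character of X x Y is
its cardinality. *)
Lemma isodyne_prod_maximally_resolvable :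
  isodyne X -> isodyne Y -> resolvable [set: X * Y] (X * Y)%type ->
  maximally_resolvable (X * Y)%type.
Proof.
move=> [[V0 [oV0 [x _] _]] leX] [[W0 [oW0 [y _] _]] leY] res; exists setT.
split=> //; split.
  by exists setT; split=> //; [exact: openT|exists (x, y)].
move=> O oO O0; have [V [W [oV V0' oW W0' VWO]]] := open_prod_box oO O0.
apply: card_le_trans (subset_card_le VWO).
have -> : [set: X * Y] = [set: X] `*` [set: Y] by apply/seteqP.
by apply: card_setX_le; [exact: leX|exact: leY].
Qed.
End Products.

(** For injective g and isodyne Z this holds of K = |Z|, but g may also collapse
Z to a much smaller set. *)
Definition big_on_opens (Z : topologicalType) T (g : Z -> T) U (K : set U) :=
  (exists V : set Z, open V /\ V !=set0) /\
  forall V : set Z, open V -> V !=set0 -> K #<= g @` V.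

Lemma isodyne_big_on_opens (Z : topologicalType) T (g : Z -> T) U (K : set U) :
  isodyne Z -> injective g -> K #<= [set: Z] -> big_on_opens g K.
Proof.
move=> [[V [oV V0 _]] leZ] ginj KZ; split; first by exists V.
move=> {}V {}oV {}V0; apply: card_le_trans KZ (card_le_trans (leZ _ oV V0) _).
by apply: (@card_le_intro _ _ _ _ g) => [z Vz|? ? _ _ /ginj//]; exists z.
Qed.

Section SuccessorProducts.
Variables (gch : GCH) (A B : Type).
Hypotheses (infA : infinite_set [set: A]) (AB : is_succ_card [set: A] [set: B]).

Lemma resolvable_prod_succ (X Y : topologicalType) (g : X -> B) (h : Y -> B)
    U (K : set U) :
  [set: B] #= K ->
  big_on_opens g [set: A] /\ big_on_opens h [set: B] \/
  big_on_opens g [set: B] /\ big_on_opens h [set: A] ->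
  resolvable K (X * Y)%type.
Proof.
move=> /card_eq_bij[k [kinj kK ksurj]].
have [f fP] := rectangle_coloring gch infA AB.
move=> [[[X0 gA] [Y0 hB]]|[[X0 gB] [Y0 hA]]].
  apply: (@resolvable_prod _ _ _ _ (fun u => k (f (g u.1) (h u.2)))) => //.
  move=> V W oV V0 oW W0 c /ksurj[b <-].
  have [_ [x Vx <-] [_ [y Wy <-] fb]] := fP _ _ (gA V oV V0) (hB W oW W0) b.
  by exists (x, y) => //=; rewrite fb.
apply: (@resolvable_prod _ _ _ _ (fun u => k (f (h u.2) (g u.1)))) => //.
move=> V W oV V0 oW W0 c /ksurj[b <-].
have [_ [y Wy <-] [_ [x Vx <-] fb]] := fP _ _ (hA W oW W0) (gB V oV V0) b.
by exists (x, y) => //=; rewrite fb.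
Qed.

End SuccessorProducts.

Lemma is_succ_card_eq T U T' U' (A : set T) (B : set U)
    (A' : set T') (B' : set U') :
  A #= A' -> B #= B' -> is_succ_card A B -> is_succ_card A' B'.
Proof.
move=> AA BB [[AB BA] leB]; split.
  by rewrite /card_lt -(card_le_eql AA) -(card_le_eqr AA) -(card_le_eql BB)
    -(card_le_eqr BB).
move=> V C; rewrite /card_lt -(card_le_eql AA) -(card_le_eqr AA) -(card_le_eql BB).
exact: leB.
Qed.

Lemma big_on_opens_le (Z : topologicalType) T (g : Z -> T) U V
    (K : set U) (L : set V) :
  K #<= L -> big_on_opens g L -> big_on_opens g K.
Proof.
by move=> KL [Z0 gL]; split=> // O oO O0; apply: card_le_trans KL (gL O oO O0).
Qed.

(** * Maps from spaces of given size *)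

(** A set V of size |Z| is cofinal in the initial order of Z, hence so is its
image under a map d with z <= d z for all z.  If d takes its values in a cofinal
set of least size K, then the image has at least K points. *)
Lemma cofinality_big_on_opens (Z : topologicalType) U (K : set U) :
  isodyne Z -> is_cofinality Z K -> exists g : Z -> K, big_on_opens g [set: K].
Proof.
move=> [[V0 [oV0 V00 _]] leZ] [R [[Rwo Rinit] [D Dcof DK] leK]].
have lt_wo := well_order_strict Rwo.
have [d dP] := choice (fun x => let: ex_intro2 y Dy Rxy := Dcof x in
  ex_intro (fun y => D y /\ R x y) y (conj Dy Rxy)).
have DK' : [set: D] #= [set: K].
  by rewrite (card_eql (card_setT _)) (card_eqr (card_setT _)).
have [i [iinj _ _]] := card_eq_bij DK'.
pose dD x : D := SigSub (mem_set (dP x).1).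
exists (i \o dD); split; first by exists V0.
move=> V oV V_0; rewrite (card_le_eql (card_setT _)).
have {}leK : K #<= d @` V.
  apply: leK => x.
  have [v Vv xv] : exists2 v, V v & R x v.
    apply: contrapT => nv; have [_ /negP] := Rinit x; apply.
    apply: card_le_trans (leZ _ oV V_0) (subset_card_le _) => v Vv /=.
    by apply/negP => xv; apply: nv; exists v.
  exists (d v); first by exists v.
  apply: contrapT => /negP dvx.
  have [xE|/lt_wo.2[vx|xv']] := pselect (v = x); last 2 first.
  - by rewrite xv in vx.
  - by have := strict_wo_trans lt_wo dvx xv'; rewrite (dP v).2.
  - by move: dvx; rewrite -xE (dP v).2.
apply: card_le_trans leK _.
rewrite -(card_le_eql (card_setT (d @` V))); apply/card_le_funP.
have dVD (y : set_type (d @` V)) : D (val y)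
  by have [x _ <-] := set_valP y; exact: (dP x).1.
exists (fun y => i (SigSub (mem_set (dVD y)))); split.
  by move=> y z /iinj/(congr1 val)/= /val_inj.
move=> y; have [x Vx xy] := set_valP y; exists x => //=; congr i; exact: val_inj.
Qed.

Section AlephOmega.
Hypothesis gch : GCH.

(** Under GCH these types represent the cardinals aleph_n. *)
Fixpoint beth n : Type := if n is m.+1 then set (beth m) else nat.

Lemma infinite_beth n : infinite_set [set: beth n].
Proof.
elim: n => [|n ih]; first exact: infinite_nat.
have [[le _] _] := gch ih; apply: card_le_infinite ih.
exact: card_le_trans le (card_leT _).
Qed.

Lemma is_succ_beth n : is_succ_card [set: beth n] [set: beth n.+1].
Proof.
have <- : [set S : set (beth n) | S `<=` [set: beth n]] = setT by apply/seteqP.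
exact: gch (infinite_beth (n := n)).
Qed.

Lemma is_aleph_beth n : is_aleph n [set: beth n].
Proof.
elim: n => [|n ih]; first exact: card_eqxx.
by exists (beth n), setT; split=> //; exact: is_succ_beth.
Qed.

Lemma is_aleph_unique n T (A : set T) : is_aleph n A -> A #= [set: beth n].
Proof.
elim: n T A => [//|n ih] T A [V [C [/ih Cn [CA leA]]]].
have [nn' len] := is_succ_beth n.
rewrite card_eq_le; apply/andP; split.
  by apply: leA; rewrite /card_lt (card_le_eql Cn) (card_le_eqr Cn).
by apply: len; rewrite /card_lt -(card_le_eql Cn) -(card_le_eqr Cn).
Qed.

Lemma beth_le m n : m <= n -> [set: beth m] #<= [set: beth n].
Proof.
move=> /subnK <-; elim: (n - m) => [|k ih]; first exact: card_lexx.
exact: card_le_trans ih (is_succ_beth _).1.1.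
Qed.

(** Order X in type |X| and let g x be some n such that the segment below x has
size at most aleph_n.  If g were bounded by N on a full-size V, then, V being
cofinal, all segments would have size at most aleph_N; a greedy choice would
embed X in aleph_(N+1), although X contains aleph_(N+2). *)
Lemma aleph_omega_partition X : is_aleph_omega [set: X] ->
  exists g : X -> nat, forall V : set X, [set: X] #<= V -> infinite_set (g @` V).
Proof.
move=> [bethX supX]; have [lt [lt_wo lt_seg]] := exists_initial_wo X.
have segbeth x : exists n, [set y | lt y x] #<= [set: beth n].
  apply: contrapT => nx; apply: (lt_seg x); apply: supX => n T A /is_aleph_unique An.
  rewrite (card_le_eql An); have [//|xn] := card_le_total [set: beth n] [set y | lt y x].
  by case: nx; exists n.
have [g gP] := choice segbeth.
exists g => V XV fingV.
have [N gN] : exists N, forall v, V v -> g v <= N.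
  have /finite_seqP[s sE] := fingV.
  exists (\max_(i <- s) i) => v Vv.
  have : [set` s] (g v) by rewrite -sE; exists v.
  by move=> /= gs; apply: (@leq_bigmax_seq _ _ xpredT id).
have segN x : [set y | lt y x] #<= [set: beth N].
  have [v Vv vx] : exists2 v, V v & ~ lt v x.
    apply: contrapT => nv; apply: (lt_seg x).
    apply: card_le_trans XV (subset_card_le _) => v Vv /=.
    by apply: contrapT => vx; apply: nv; exists v.
  apply: card_le_trans (card_le_trans (gP v) (beth_le (gN v Vv))).
  apply: subset_card_le => y yx /=.
  have [<-//|/lt_wo.2[xv|/vx//]] := pselect (x = v).
  exact: (strict_wo_trans lt_wo) yx xv.
have [x nx|p [pinj _]] := greedy_choice lt_wo (S := fun=> [set: beth N.+1]).
  have [[_ /negP nle] _] := is_succ_beth N.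
  exact: nle (card_le_trans nx (segN x)).
have [[_ /negP nle] _] := is_succ_beth N.+1; apply: nle.
apply: card_le_trans (bethX N.+2 _ _ (is_aleph_beth N.+2)) _.
by apply/card_le_funP; exists p.
Qed.

End AlephOmega.

Theorem mainTheorem4 (gch : GCH) (X Y : topologicalType)
    (isoX : isodyne X) (isoY : isodyne Y) :
  [/\ [set: X] #= [set: Y] -> isolated_cardinal [set: X] ->
        maximally_resolvable (X * Y)%type,
      forall (U : Type) (K : set U),
        is_cofinality X K -> is_cofinality Y K -> isolated_cardinal K ->
        resolvable K (X * Y)%type,
      neighboring [set: X] [set: Y] -> maximally_resolvable (X * Y)%type &
      forall (U : Type) (W : set U),
        is_aleph 1 W -> is_aleph_omega [set: X] -> [set: Y] #= W ->
        resolvable W (X * Y)%type].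
Proof.
have X0 : [set: X] !=set0 by have [[V [_ [x _] _]] _] := isoX; exists x.
have Y0 : [set: Y] !=set0 by have [[V [_ [x _] _]] _] := isoY; exists x.
split.
- move=> XY [T [A [/infinite_setT_sub infA AX]]].
  have {}AX : is_succ_card [set: A] [set: X].
    by apply: is_succ_card_eq AX; [exact: card_setT_sym|exact: card_eqxx].
  have [[AleX _] _] := AX.
  have infX := card_le_infinite AleX infA.
  have YX : [set: Y] #<= [set: X] by rewrite (card_le_eql (card_esym XY)) card_lexx.
  have /card_le_funP[h [hinj _]] := YX.
  apply: isodyne_prod_maximally_resolvable => //.
  apply: (resolvable_prod_succ gch infA AX (g := id) (h := h)).
    apply: card_eq_trans (card_prodC _ _).
    exact/card_esym/card_prod_absorb.
  left; split; first exact: isodyne_big_on_opens.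
  by apply: isodyne_big_on_opens => //; case/andP: (etrans (esym (card_eq_le _ _)) XY).
- move=> U K cofX cofY [T [A [/infinite_setT_sub infA AK]]].
  have {}AK : is_succ_card [set: A] [set: K].
    by apply: is_succ_card_eq AK; exact: card_setT_sym.
  have [g gK] := cofinality_big_on_opens isoX cofX.
  have [h hK] := cofinality_big_on_opens isoY cofY.
  apply: (resolvable_prod_succ gch infA AK (g := g) (h := h)); first exact: card_setT.
  by left; split=> //; apply: big_on_opens_le gK; case: AK.1.
- move=> XY; apply: isodyne_prod_maximally_resolvable => //.
  case: XY => -[inf succ]; have [[le _] _] := succ.
    have /card_le_funP[g [ginj _]] := le.
    apply: (resolvable_prod_succ gch inf succ (g := g) (h := id)).
      exact/card_esym/(card_prod_absorb (card_le_infinite le inf)).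
    by left; split; apply: isodyne_big_on_opens => //; exact: card_lexx.
  have /card_le_funP[h [hinj _]] := le.
  apply: (resolvable_prod_succ gch inf succ (g := id) (h := h)).
    apply: card_eq_trans (card_prodC _ _).
    exact/card_esym/(card_prod_absorb (card_le_infinite le inf)).
  by right; split; apply: isodyne_big_on_opens => //; exact: card_lexx.
- move=> U W [T [A [/= Anat AW]]] omegaX YW.
  have {}AW : is_succ_card [set: nat] [set: W].
    by apply: is_succ_card_eq AW => //; exact: card_setT_sym.
  have [g gV] := aleph_omega_partition gch omegaX.
  have [[/card_le_funP[j [jinj _]] _] _] := AW.
  have YW' : [set: Y] #= [set: W] by rewrite (card_eqr (card_setT _)).
  have [h [hinj _ _]] := card_eq_bij YW'.
  apply: (resolvable_prod_succ gch infinite_nat AW (g := j \o g) (h := h)).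
    exact: card_setT.
  left; split; last first.
    by apply: isodyne_big_on_opens => //; rewrite (card_le_eqr YW') card_lexx.
  have [[V0 [oV0 V00 _]] leX] := isoX; split; first by exists V0.
  move=> V oV Vn; have /infiniteP/card_le_trans := gV V (leX V oV Vn); apply.
  apply: (@card_le_intro _ _ _ _ j) => [_ [x Vx <-]|m n _ _ /jinj//].
  by exists x.
Qed.
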